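(* Let $n$ be even and let $G=(V,E)\sim G(n,1/2)$ with $V=[n]$. Let $X$ be the $\pm1$ adjacency matrix of $G$, with spectral decomposition $X=\sum_{k=1}^n\lambda_k u_ku_k^T$, $\lambda_1\ge\dots\ge\lambda_n$, $u_1,\dots,u_n$ orthonormal. Let $X^+=\sum_{k=1}^{n/2}\lambda_ku_ku_k^T$, $X^-=\sum_{k=n/2+1}^{n}\lambda_ku_ku_k^T$, and $Z=X^--X^+$. Then for any $\varepsilon\in(0,1/4)$, with probability at least $1-O(n^{-1}\,\mathrm{polylog}\, n)$, $$\frac{1}{|E|}\sum_{(i,j)\in E}X^+_{ij}=\frac12\pm O(n^{2\varepsilon-1/2}),\qquad \frac{1}{|E|}\sum_{(i,j)\in E}X^-_{ij}=\frac12\pm O(n^{2\varepsilon-1/2}),$$ $$\frac{1}{|\overline{E}|}\sum_{(i,j)\notin E}X^+_{ij}=-\frac12\pm O(n^{2\varepsilon-1/2}),\qquad \frac{1}{|\overline{E}|}\sum_{(i,j)\notin E}X^-_{ij}=-\frac12\pm O(n^{2\varepsilon-1/2}).$$ Consequently, $\left|\frac{1}{|E|}\sum_{(i,j)\in E}Z_{ij}\right|\le O(n^{2\varepsilon-1/2})$ and $\left|\frac{1}{|\overline{E}|}\sum_{(i,j)\notin E}Z_{ij}\right|\le O(n^{2\varepsilon-1/2})$.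
   Context: $G(n,1/2)$ is the Erdős–Rényi random graph on $[n]$ where each pair is an edge independently with probability $1/2$. The $\pm1$ adjacency matrix $X$ of $G$ is the symmetric matrix with $X_{ii}=0$, $X_{ij}=1$ if $\{i,j\}$ is an edge and $X_{ij}=-1$ otherwise ($i\ne j$). Here $E$ is regarded as the set of ordered pairs $(i,j)$ with $\{i,j\}$ an edge, sums over $(i,j)\notin E$ range over ordered pairs in $[n]^2$ not in $E$, and $\overline{E}$ denotes that set of pairs. *)

(* Defs.v *)
From HB Require Import structures.
From mathcomp Require Import all_boot all_order all_algebra.
From mathcomp Require Import all_classical all_reals all_analysis.
Set Implicit Arguments. Unset Strict Implicit. Unset Printing Implicit Defensive.
Import Order.TTheory GRing.Theory Num.Theory.
Local Open Scope ring_scope.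

Definition upair (n : nat) := {p : 'I_n * 'I_n | (p.1 < p.2)%N}.

(* A graph on [n] = a choice of edge / non-edge for every unordered pair.
   G(n,1/2) is the uniform distribution on this finite type. *)
Definition graph (n : nat) := {ffun upair n -> bool}.

Definition edgeb n (g : graph n) (i j : 'I_n) : bool :=
  [exists p : upair n, g p && ((val p == (i, j)) || (val p == (j, i)))].

Definition Pr (R : realType) n (P : graph n -> Prop) : R :=
  #|[set g : graph n | `[< P g >]]|%:R / #|{: graph n}|%:R.

Definition pmadj (R : realType) n (g : graph n) : 'M[R]_n :=
  \matrix_(i, j) (if i == j then 0 else if edgeb g i j then 1 else -1).

Definition spec_decomp (R : realType) n (A : 'M[R]_n) (lam : 'I_n -> R)
    (U : 'M[R]_n) : Prop :=
  [/\ U^T *m U = 1%:M,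
      A = \sum_(k < n) lam k *: (col k U *m (col k U)^T)
    & forall k l : 'I_n, (k <= l)%N -> lam l <= lam k].

Definition Xplus (R : realType) n (lam : 'I_n -> R) (U : 'M[R]_n) : 'M[R]_n :=
  \sum_(k < n | (k < n./2)%N) lam k *: (col k U *m (col k U)^T).

Definition Xminus (R : realType) n (lam : 'I_n -> R) (U : 'M[R]_n) : 'M[R]_n :=
  \sum_(k < n | (n./2 <= k)%N) lam k *: (col k U *m (col k U)^T).

(* (1/|E|) sum_{(i,j) in E} M_ij  and  (1/|Ebar|) sum_{(i,j) notin E} M_ij,
   over ordered pairs of [n]^2 (the non-edge set includes the diagonal). *)
Definition avgE (R : realType) n (g : graph n) (M : 'M[R]_n) : R :=
  (\sum_(p : 'I_n * 'I_n | edgeb g p.1 p.2) M p.1 p.2)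
  / #|[set p : 'I_n * 'I_n | edgeb g p.1 p.2]|%:R.

Definition avgNE (R : realType) n (g : graph n) (M : 'M[R]_n) : R :=
  (\sum_(p : 'I_n * 'I_n | ~~ edgeb g p.1 p.2) M p.1 p.2)
  / #|[set p : 'I_n * 'I_n | ~~ edgeb g p.1 p.2]|%:R.

Definition goodA7 (R : realType) n (b : R) (g : graph n) : Prop :=
  forall (lam : 'I_n -> R) (U : 'M[R]_n), spec_decomp (pmadj R g) lam U ->
    let Xp := Xplus lam U in
    let Xm := Xminus lam U in
    let Z := Xm - Xp in
    (`|avgE g Xp - 2^-1| <= b /\ `|avgE g Xm - 2^-1| <= b /\
     `|avgNE g Xp + 2^-1| <= b /\ `|avgNE g Xm + 2^-1| <= b /\
     `|avgE g Z| <= b /\ `|avgNE g Z| <= b).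

(* Main.v *)
(* Write D for the sum of lambda_k^2 over the upper half of the spectrum minus the sum over the
   lower half, and <X, M> for the entrywise inner product.  Since the indicator of E is
   (X + J - I) / 2, the sum of M over E is (<X, M> + 1^T M 1 - tr M) / 2, and for M = X^+ or X^-
   the leading term <X, M> is (n (n - 1) + D) / 2 or (n (n - 1) - D) / 2.
   The terms 1^T M 1, tr M and 1^T X 1 are O(n^(3/2)) as soon as |X 1|^2 <= 2 n^2.

   No spectral rigidity is needed to bound D.  For an odd function f with Lipschitz derivative,
   tr f(X) has mean zero because X and - X have the same law, and its variance is O(n^2) when
   |f'(x)| <= C |x|: flipping one edge changes tr f(X) by a multiple of f'(X)_ij up to O(1)
   (Klein's inequality), the squares of the entries of f'(X) add up to O(tr X^2), and the
   Poincare inequality on the discrete cube sums the contributions.  Taking f(x) = x |x| bounds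
   D up to the eigenvalues of the wrong sign between the median and 0; these are controlled by
   truncations of x |x| at the dyadic scale of the median, and the union bound over the O(log n)
   scales is the only source of the logarithm. *)

Require Import Defs.
From HB Require Import structures.
From mathcomp Require Import all_boot all_order all_algebra.
From mathcomp Require Import all_classical all_reals all_analysis.
From mathcomp Require Import complex ring lra zify.
Import Order.TTheory GRing.Theory Num.Theory.
Local Open Scope ring_scope.
Set Implicit Arguments. Unset Strict Implicit. Unset Printing Implicit Defensive.

(** * Real spectral theorem *)

Lemma row_norm_sq_ge0 (R : realDomainType) n (x : 'rV[R]_n) : 0 <= (x *m x^T) 0 0.
Proof. by rewrite mxE sumr_ge0 // => j _; rewrite mxE -expr2 sqr_ge0. Qed.

Lemma row_norm_sq_eq0 (R : realDomainType) n (x : 'rV[R]_n) :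
  ((x *m x^T) 0 0 == 0) = (x == 0).
Proof.
apply/eqP/eqP => [|->]; last by rewrite mul0mx mxE.
rewrite mxE => /eqP; rewrite psumr_eq0; last first.
  by move=> j _; rewrite mxE -expr2 sqr_ge0.
move=> /allP H; apply/rowP=> j; rewrite mxE.
have := H j (mem_index_enum _); rewrite mxE /= -expr2 sqrf_eq0.
by move=> /eqP.
Qed.

(** Over the complex numbers the characteristic polynomial has a root [z], with row eigenvector
    [x + i y]. Symmetry equates [x A y^T] with [y A x^T], which forces [Im z * (|x|^2 + |y|^2) = 0].
    So [z] is real, and whichever of [x], [y] is nonzero is a real eigenvector. *)
Lemma symmetric_real_eigenvector (R : rcfType) n (A : 'M[R]_n.+1) :
  A^T = A -> exists (a : R) (v : 'rV[R]_n.+1), v != 0 /\ v *m A = a *: v.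
Proof.
move=> Asym.
pose AC : 'M[complex R]_n.+1 := map_mx (real_complex R) A.
have : size (char_poly AC) != 1%N by rewrite size_char_poly.
move=> /closed_rootP [z]; rewrite -eigenvalue_root_char.
move=> /eigenvalueP [v vA v0].
pose x := map_mx (@complex.Re R) v; pose y := map_mx (@complex.Im R) v.
have xA : x *m A = complex.Re z *: x - complex.Im z *: y.
  apply/rowP=> j; have /rowP/(_ j) := vA; rewrite !mxE => /(congr1 (@complex.Re R)).
  rewrite raddf_sum /= => H; apply: etrans (etrans _ H) _.
    by apply: eq_bigr => k _; rewrite !mxE; case: (v 0 k) => s t /=; ring.
  by case: (z) => s t; case: (v 0 j) => s' t' /=.
have yA : y *m A = complex.Im z *: x + complex.Re z *: y.
  apply/rowP=> j; have /rowP/(_ j) := vA; rewrite !mxE => /(congr1 (@complex.Im R)).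
  rewrite raddf_sum /= => H; apply: etrans (etrans _ H) _.
    by apply: eq_bigr => k _; rewrite !mxE; case: (v 0 k) => s t /=; ring.
  by case: (z) => s t; case: (v 0 j) => s' t' /=; ring.
have xy0 : (x != 0) || (y != 0).
  rewrite -negb_and; apply: contra v0 => /andP[/eqP x0 /eqP y0].
  apply/eqP/rowP=> j; rewrite mxE; move/rowP/(_ j): x0; move/rowP/(_ j): y0.
  by rewrite !mxE; case: (v 0 j) => s t /= -> ->.
have b0 : complex.Im z = 0.
  have tr11 (M : 'M[R]_1) : M 0 0 = M^T 0 0 by rewrite mxE.
  have subE (M N : 'M[R]_1) : (M - N) 0 0 = M 0 0 - N 0 0 by rewrite !mxE.
  have addE (M N : 'M[R]_1) : (M + N) 0 0 = M 0 0 + N 0 0 by rewrite !mxE.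
  have scE c (M : 'M[R]_1) : (c *: M) 0 0 = c * M 0 0 by rewrite !mxE.
  have E : (x *m A *m y^T) 0 0 = (y *m A *m x^T) 0 0.
    by rewrite tr11 !trmx_mul trmxK Asym mulmxA.
  have yx : (y *m x^T) 0 0 = (x *m y^T) 0 0 by rewrite tr11 trmx_mul trmxK.
  move: E; rewrite xA yA mulmxBl mulmxDl -!scalemxAl subE addE !scE yx => E.
  have px := row_norm_sq_ge0 x; have py := row_norm_sq_ge0 y.
  have H : complex.Im z * ((x *m x^T) 0 0 + (y *m y^T) 0 0) = 0 by lra.
  move/eqP: H; rewrite mulf_eq0 => /orP[/eqP //|].
  by rewrite paddr_eq0 // !row_norm_sq_eq0 -[_ && _]negbK negb_and xy0.
case/orP: xy0 => h.
  by exists (complex.Re z), x; split => //; rewrite xA b0 scale0r subr0.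
by exists (complex.Re z), y; split => //; rewrite yA b0 scale0r add0r.
Qed.

(* Householder reflection in the hyperplane orthogonal to [w = v - e], which exchanges the
   unit vectors [v] and [e]. *)
Lemma orthogonal_map_unit_vector (R : realFieldType) n (v e : 'rV[R]_n) :
  v *m v^T = 1%:M -> e *m e^T = 1%:M ->
  exists H : 'M[R]_n, H^T *m H = 1%:M /\ e *m H = v.
Proof.
move=> vv ee; have [->|ve] := eqVneq v e.
  by exists 1%:M; rewrite trmx1 !mulmx1.
have [w wE] : exists w, w = v - e by exists (v - e).
have [s sD] : exists s, s = (w *m w^T) 0 0 by exists ((w *m w^T) 0 0).
have s0 : s != 0 by rewrite sD row_norm_sq_eq0 wE subr_eq0.
have ev : (v *m e^T) 0 0 = (e *m v^T) 0 0.
  by rewrite -[in RHS](trmxK e) -trmx_mul [RHS]mxE.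
have ww : w *m w^T = s%:M by rewrite [LHS]mx11_scalar -sD.
have sE : s = 2 - 2 * (e *m v^T) 0 0.
  rewrite sD wE linearB /= mulmxBl !mulmxBr vv ee.
  have -> : forall a b c d : 'M[R]_1, (a - b - (c - d)) 0 0 = a 0 0 - b 0 0 - c 0 0 + d 0 0.
    by move=> a b c d; rewrite !mxE; ring.
  by rewrite ev !mxE /=; ring.
exists (1%:M - (2 / s) *: (w^T *m w)); split.
  have -> : (1%:M - (2 / s) *: (w^T *m w))^T = 1%:M - (2 / s) *: (w^T *m w).
    by rewrite [LHS]linearB /= trmx1 [X in _ - X]linearZ /= trmx_mul trmxK.
  rewrite mulmxBl mul1mx mulmxBr mulmx1 -scalemxAl -scalemxAr mulmxA -(mulmxA _ w).
  rewrite ww mul_mx_scalar -scalemxAl !scalerA.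
  move: (w^T *m w) => M.
  by apply/matrixP=> i j; rewrite !mxE; field.
rewrite mulmxBr mulmx1 -scalemxAr mulmxA.
(* Here [s = |v - e|^2 = 2 - 2 <e, v>], so [<e, w> = - s / 2] and the reflection sends [e] to
   [e + w = v]. *)
have -> : e *m w^T = (- (s / 2))%:M.
  rewrite [LHS]mx11_scalar wE linearB /= mulmxBr ee sE; congr (_%:M).
  by rewrite !mxE /=; field.
rewrite mul_scalar_mx scalerA.
have -> : 2 / s * - (s / 2) = -1 by field.
by rewrite scaleN1r opprK wE addrC subrK.
Qed.

(** Deflation: an orthogonal change of basis moves a unit eigenvector to the first basis vector. By
    symmetry the first row and column then vanish off the diagonal, and induction applies to the
    remaining block. *)
Theorem symmetric_spectral (R : rcfType) n (A : 'M[R]_n) : A^T = A ->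
  exists (U : 'M[R]_n) (a : 'rV[R]_n), U^T *m U = 1%:M /\ A = U *m diag_mx a *m U^T.
Proof.
elim: n A => [|n IHn] A Asym.
  by exists 1%:M, 0; split; apply/matrixP; case.
have [a [v0 [v0n v0A]]] := symmetric_real_eigenvector Asym.
pose v := (Num.sqrt ((v0 *m v0^T) 0 0))^-1 *: v0.
have vv : v *m v^T = 1%:M.
  rewrite [LHS]mx11_scalar; congr (_%:M).
  have tZ (k : R) (u : 'rV[R]_n.+1) : (k *: u)^T = k *: u^T by rewrite linearZ.
  have scE c (M : 'M[R]_1) : (c *: M) 0 0 = c * M 0 0 by rewrite !mxE.
  rewrite /v tZ -scalemxAl -scalemxAr scalerA scE -expr2 exprVn sqr_sqrtr ?row_norm_sq_ge0 //.
  by rewrite mulVf // row_norm_sq_eq0.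
have vA : v *m A = a *: v by rewrite /v -scalemxAl v0A !scalerA mulrC.
pose e : 'rV[R]_n.+1 := delta_mx 0 0.
have ee : e *m e^T = 1%:M by rewrite trmx_delta mul_delta_mx; apply/matrixP=> i j; rewrite !ord1 !mxE.
have [H [HH eH]] := orthogonal_map_unit_vector vv ee.
have HH' := mulmx1C HH.
have [B BD] : exists B : 'M[R]_(1 + n), B = H *m A *m H^T by exists (H *m A *m H^T).
have Bsym : B^T = B by rewrite BD !trmx_mul trmxK Asym mulmxA.
have eB : e *m B = a *: e.
  by rewrite BD !mulmxA eH vA -scalemxAl -eH -mulmxA HH' mulmx1.
have B00 j : B 0 j = a * (j == 0)%:R.
  by move/rowP/(_ j): eB; rewrite -rowE mxE => ->; rewrite !mxE.
have L0 (i : 'I_1) : lshift n i = 0 by apply/val_inj; rewrite (ord1 i).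
have Rn0 (i : 'I_n) : (rshift 1 i == 0) = false by apply/eqP => /(congr1 val).
have Bb : B = block_mx a%:M 0 0 (drsubmx B).
  rewrite -[LHS]submxK; congr block_mx.
  - by apply/matrixP=> i j; rewrite !ord1 !mxE !L0 B00 eqxx mulr1.
  - by apply/matrixP=> i j; rewrite ord1 !mxE L0 B00 Rn0 mulr0.
  - by apply/matrixP=> i j; rewrite (ord1 j) !mxE L0 -Bsym mxE B00 Rn0 mulr0.
have Csym : (drsubmx B)^T = drsubmx B by rewrite trmx_drsub Bsym.
have [V [c [VV Cd]]] := IHn _ Csym.
pose W : 'M[R]_(1 + n) := block_mx 1%:M 0 0 V.
have WW : W^T *m W = 1%:M.
  rewrite /W tr_block_mx !trmx0 trmx1 mulmx_block !mulmx0 !mul0mx !mulmx1 VV.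
  by rewrite !addr0 add0r -scalar_mx_block.
exists (H^T *m W), (row_mx a%:M c); split.
  by rewrite trmx_mul trmxK -mulmxA (mulmxA H) HH' mul1mx.
have AB : A = H^T *m B *m H by rewrite BD !mulmxA HH mul1mx -mulmxA HH mulmx1.
have BW : B = W *m diag_mx (row_mx a%:M c : 'rV_(1 + n)) *m W^T.
  rewrite [LHS]Bb Cd /W tr_block_mx !trmx0 trmx1 diag_mx_row !mulmx_block.
  rewrite !mulmx0 !mul0mx !mulmx1 !mul1mx !addr0 !add0r.
  by congr block_mx; rewrite ?mul0mx //; apply/matrixP=> i j; rewrite !mxE !ord1 /=.
by rewrite AB BW trmx_mul trmxK !mulmxA.
Qed.

(** * Linear spectral statistics and Klein's inequality *)

Definition specmx (R : realType) n (U : 'M[R]_n) (a : 'I_n -> R) : 'M[R]_n :=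
  \sum_(k < n) a k *: (col k U *m (col k U)^T).

Section Klein.
Variables (R : realType) (n : nat).
Implicit Types (U V : 'M[R]_n) (a b : 'I_n -> R).

Lemma specmxE U a i j : specmx U a i j = \sum_(k < n) a k * (U i k * U j k).
Proof.
rewrite summxE; apply: eq_bigr => k _; rewrite !mxE big_ord1.
by rewrite !mxE.
Qed.

Lemma specmx_mul U a : specmx U a = U *m diag_mx (\row_k a k) *m U^T.
Proof.
apply/matrixP=> i j; rewrite specmxE mxE; apply: eq_bigr => k _.
by rewrite mul_mx_diag !mxE; ring.
Qed.

Lemma specmx_sym U a : (specmx U a)^T = specmx U a.
Proof. by rewrite specmx_mul !trmx_mul trmxK tr_diag_mx mulmxA. Qed.

Lemma specmx1 U : U^T *m U = 1%:M -> specmx U (fun=> 1) = 1%:M.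
Proof.
move=> /mulmx1C UU; rewrite specmx_mul -[RHS]UU; congr (_ *m _).
rewrite -[RHS]mulmx1; congr (_ *m _).
by apply/matrixP=> i j; rewrite !mxE.
Qed.

Lemma specmxM U a b : U^T *m U = 1%:M ->
  specmx U a *m specmx U b = specmx U (fun k => a k * b k).
Proof.
move=> UU; rewrite !specmx_mul !mulmxA -(mulmxA _ U^T U) UU mulmx1.
congr (_ *m _); rewrite -mulmxA mulmx_diag; congr (_ *m diag_mx _).
by apply/rowP=> k; rewrite !mxE.
Qed.

Lemma mxtrace_specmxM U V a b :
  \tr (specmx U a *m specmx V b) =
  \sum_(k < n) \sum_(l < n) a k * b l * (U^T *m V) k l ^+ 2.
Proof.
rewrite !specmx_mul -!mulmxA mxtrace_mulC -!mulmxA.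
rewrite (mulmxA U^T) -[V^T *m U]trmxK trmx_mul trmxK.
move: (U^T *m V) => W.
apply: eq_bigr => k _; rewrite mul_diag_mx mxE [X in X * _]mxE mxE mulr_sumr.
by apply: eq_bigr => l _; rewrite mul_diag_mx !mxE; ring.
Qed.

Lemma mxtrace_specmx U a : U^T *m U = 1%:M -> \tr (specmx U a) = \sum_k a k.
Proof.
move=> UU; rewrite specmx_mul -mulmxA mxtrace_mulC -mulmxA UU mulmx1 mxtrace_diag.
by apply: eq_bigr => k _; rewrite mxE.
Qed.

(* With [w k l = <u_k, v_l>^2] doubly stochastic, every trace below is a [w]-average over
   pairs of eigenvalues, so the scalar Taylor estimate can be averaged (Klein's inequality). *)
Lemma mxtrace_taylor (f f' : R -> R) (L : R) U V a b D :
  (forall x y, `|f y - f x - f' x * (y - x)| <= L * (y - x) ^+ 2) ->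
  U^T *m U = 1%:M -> V^T *m V = 1%:M ->
  D = specmx V b - specmx U a ->
  `|\sum_l f (b l) - \sum_k f (a k) - \tr (specmx U (fun k => f' (a k)) *m D)|
    <= L * \tr (D *m D).
Proof.
move=> fL UU VV DE.
pose S (p : 'I_n -> 'I_n -> R) := \sum_k \sum_l p k l * (U^T *m V) k l ^+ 2.
have SD p q : S p + S q = S (fun k l => p k l + q k l).
  rewrite /S -big_split; apply: eq_bigr => k _; rewrite -big_split.
  by apply: eq_bigr => l _; rewrite mulrDl.
have SZ c p : c * S p = S (fun k l => c * p k l).
  rewrite /S mulr_sumr; apply: eq_bigr => k _; rewrite mulr_sumr.
  by apply: eq_bigr => l _; rewrite mulrA.
have SN p : - S p = S (fun k l => - p k l).
  by rewrite -mulN1r SZ; congr S; apply/funext=> k; apply/funext=> l; rewrite mulN1r.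
have trS p q : \tr (specmx U p *m specmx V q) = S (fun k l => p k * q l).
  exact: mxtrace_specmxM.
(* Inserting the identity, written in the other eigenbasis, turns the trace of a single matrix into
   a double sum with the same weights. This is where double stochasticity enters. *)
have trU p : \tr (specmx U p) = S (fun k l => p k).
  rewrite -[specmx U p]mulmx1 -(specmx1 VV) trS; congr S.
  by apply/funext=> k; apply/funext=> l; rewrite mulr1.
have trV q : \tr (specmx V q) = S (fun k l => q l).
  rewrite -[specmx V q]mul1mx -(specmx1 UU) trS; congr S.
  by apply/funext=> k; apply/funext=> l; rewrite mul1r.
have -> : \tr (D *m D) = S (fun k l => (b l - a k) ^+ 2).
  rewrite DE mulmxBl !mulmxBr !raddfB /= !specmxM // (mxtrace_mulC (specmx V b)) trS trU trV.
  rewrite !SN !SD; congr S.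
  by apply/funext=> k; apply/funext=> l; ring.
have -> : \sum_l f (b l) - \sum_k f (a k) - \tr (specmx U (fun k => f' (a k)) *m D)
    = S (fun k l => f (b l) - f (a k) - f' (a k) * (b l - a k)).
  rewrite DE mulmxBr raddfB /= specmxM // trS trU.
  rewrite -(mxtrace_specmx (fun l => f (b l)) VV) -(mxtrace_specmx (fun k => f (a k)) UU).
  rewrite trU trV !SN !SD !SN !SD; congr S.
  by apply/funext=> k; apply/funext=> l; ring.
rewrite SZ (le_trans (ler_norm_sum _ _ _)) //; apply: ler_sum => k _.
rewrite (le_trans (ler_norm_sum _ _ _)) //; apply: ler_sum => l _.
by rewrite normrM (ger0_norm (sqr_ge0 _)) ler_wpM2r ?sqr_ge0.
Qed.

End Klein.

(** * Poincare inequality on the discrete cube *)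

Section Poincare.
Variables (R : realFieldType) (T : finType).
Local Notation cube := {ffun T -> bool}.
Implicit Types (F H : cube -> R) (t r : T) (g : cube).

Definition flip t g : cube := [ffun s => if s == t then ~~ g s else g s].

Definition avg_flip t F : cube -> R := fun g => (F g + F (flip t g)) / 2.

Lemma flipK t : involutive (flip t).
Proof. by move=> g; apply/ffunP=> s; rewrite !ffunE; case: eqP => // _; rewrite negbK. Qed.

Lemma flipC t r g : flip t (flip r g) = flip r (flip t g).
Proof. by apply/ffunP=> s; rewrite !ffunE; case: (s == t); case: (s == r). Qed.

Lemma sum_flip t F : \sum_g F (flip t g) = \sum_g F g.
Proof. by rewrite [RHS](reindex_inj (inv_inj (flipK t))). Qed.

Lemma sum_avg_flip t F : \sum_g avg_flip t F g = \sum_g F g.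
Proof. by rewrite -mulr_suml big_split /= sum_flip; field. Qed.

(** Pythagoras on each pair [{g, flip t g}]: the mean square of two values is the square of their
    mean plus the square of half their difference. *)
Lemma sum_sqr_avg_flip t F :
  \sum_g F g ^+ 2 = \sum_g avg_flip t F g ^+ 2 + 4^-1 * \sum_g (F (flip t g) - F g) ^+ 2.
Proof.
have E : \sum_g F g ^+ 2 = \sum_g (F g ^+ 2 + F (flip t g) ^+ 2) / 2.
  by rewrite -mulr_suml big_split /= (sum_flip t (fun g => F g ^+ 2)); field.
rewrite E mulr_sumr -big_split; apply: eq_bigr => g _.
by rewrite /avg_flip /=; field.
Qed.

Lemma sum_sqr_avg_flip_le t F : \sum_g avg_flip t F g ^+ 2 <= \sum_g F g ^+ 2.
Proof.
rewrite [leRHS](sum_sqr_avg_flip t) lerDl mulr_ge0 //.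
by apply: sumr_ge0 => g _; rewrite sqr_ge0.
Qed.

Definition avg_flips (s : seq T) F := foldl (fun H t => avg_flip t H) F s.

Lemma sum_avg_flips s F : \sum_g avg_flips s F g = \sum_g F g.
Proof. by elim: s F => //= t s IHs F; rewrite IHs sum_avg_flip. Qed.

(** Each averaging loses a quarter of the squared differences in its own direction. Since flips
    commute, averaging along [t] does not increase the differences along [r], so every loss is
    bounded in terms of the original [F]. *)
Lemma sum_sqr_avg_flips s F :
  \sum_g F g ^+ 2 <= \sum_g avg_flips s F g ^+ 2
    + 4^-1 * \sum_(t <- s) \sum_g (F (flip t g) - F g) ^+ 2.
Proof.
elim: s F => [|t s IHs] F /=; first by rewrite big_nil mulr0 addr0.
rewrite (sum_sqr_avg_flip t) big_cons mulrDr.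
have IH := IHs (avg_flip t F).
suff : \sum_(r <- s) \sum_g (avg_flip t F (flip r g) - avg_flip t F g) ^+ 2
    <= \sum_(r <- s) \sum_g (F (flip r g) - F g) ^+ 2 by lra.
apply: ler_sum => r _.
have -> : \sum_g (avg_flip t F (flip r g) - avg_flip t F g) ^+ 2 =
   \sum_g avg_flip t (fun g => F (flip r g) - F g) g ^+ 2.
  apply: eq_bigr => g _; congr (_ ^+ 2); rewrite /avg_flip (flipC t r).
  by field.
exact: sum_sqr_avg_flip_le.
Qed.

(** The disjunction makes the induction go through: invariance under [flip t] appears when [t] is
    averaged and survives all later averagings. *)
Lemma avg_flips_invariant s F t g :
  (forall g, F (flip t g) = F g) \/ t \in s -> avg_flips s F (flip t g) = avg_flips s F g.
Proof.
elim: s F => [|r s IHs] F /=; first by case.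
case=> [Ft|]; last rewrite inE => /orP[/eqP <-|ts].
- by apply: IHs; left => h; rewrite /avg_flip flipC !Ft.
- by apply: IHs; left => h; rewrite /avg_flip flipK addrC.
- by apply: IHs; right.
Qed.

Lemma flip_invariant_const F : (forall t g, F (flip t g) = F g) -> forall g h, F g = F h.
Proof.
move=> Fi g h; have [m] := ubnP #|[pred t | g t != h t]|.
elim: m g => // m IHm g; rewrite ltnS => gh.
have [t /= gt|e] := pickP [pred t | g t != h t]; last first.
  by congr F; apply/ffunP=> t; apply/eqP; have := e t; rewrite /= => /negbFE.
rewrite -(Fi t); apply: IHm; apply: leq_trans gh.
apply/proper_card/properP; split.
  apply/fintype.subsetP=> r; rewrite !inE /flip ffunE; have [->|_ //] := eqVneq r t.
  by case: (g t) (h t) gt => [] [].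
exists t; rewrite !inE //= ffunE eqxx.
by case: (g t) (h t) gt => [] [].
Qed.

(** Once all coordinates are averaged out the function is constant. Its sum is still 0, so it
    vanishes and only the losses remain. *)
Theorem cube_poincare F : \sum_g F g = 0 ->
  \sum_g F g ^+ 2 <= 4^-1 * \sum_t \sum_g (F (flip t g) - F g) ^+ 2.
Proof.
move=> F0; have := sum_sqr_avg_flips (enum T) F.
rewrite [X in _ <= X + _]big1 ?add0r; last first.
  move=> g _; have /flip_invariant_const c : forall t g,
      avg_flips (enum T) F (flip t g) = avg_flips (enum T) F g.
    by move=> t h; apply: avg_flips_invariant; right; rewrite mem_enum.
  have := sum_avg_flips (enum T) F; rewrite F0.
  rewrite (eq_bigr (fun=> avg_flips (enum T) F g)) => [|h _]; last exact: c.
  rewrite sumr_const => /eqP; rewrite mulrn_eq0 => /orP[|/eqP ->].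
    by rewrite -leqn0 leqNgt; case/negP; apply/card_gt0P; exists g.
  by rewrite expr0n.
by rewrite big_enum.
Qed.

End Poincare.

Lemma chebyshev_card (R : realFieldType) (T : finType) (F : T -> R) (A B : R) :
  0 < A -> \sum_g F g ^+ 2 <= B ->
  #|[set g | A < `|F g|]|%:R * A ^+ 2 <= B.
Proof.
move=> A0; apply: le_trans.
rewrite mulr_natl -sumr_const.
rewrite [leRHS](bigID (fun g => A < `|F g|)) /= -[leLHS]addr0 lerD //; last first.
  by rewrite sumr_ge0 // => g _; rewrite sqr_ge0.
rewrite (eq_bigl (fun g => A < `|F g|)) => [|g]; last by rewrite inE.
by apply: ler_sum => g h; rewrite -(real_normK (num_real (F g))) lerXn2r ?nnegrE ?(ltW A0) ?(ltW h).
Qed.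

(** * Spectral statistics of a random graph *)

Section Graph.
Variables (R : realType) (n : nat).
Implicit Types (g : graph n) (e : upair n) (i j : 'I_n).
Local Notation X := (pmadj R).

Lemma upair_lt e : ((val e).1 < (val e).2)%N.
Proof. exact: (valP e). Qed.

Lemma edgebC g i j : edgeb g i j = edgeb g j i.
Proof. by apply: eq_existsb => e; rewrite orbC. Qed.

Lemma edgebii g i : edgeb g i i = false.
Proof.
apply/existsP => -[[[k l] /= kl] /andP[_]].
by rewrite /= orbb => /eqP [ki li]; rewrite ki li ltnn in kl.
Qed.

Lemma edgeb_upair g e : edgeb g (val e).1 (val e).2 = g e.
Proof.
apply/existsP/idP => [[e' /andP[ge' /orP[]]]|ge].
- by rewrite -surjective_pairing (inj_eq val_inj) => /eqP <-.
- move=> /eqP h; have := valP e'; have := valP e; rewrite h /= => a b.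
  by have := ltn_trans a b; rewrite ltnn.
- by exists e; rewrite ge -surjective_pairing eqxx.
Qed.

Lemma upairP i j : i != j -> exists e, val e = (i, j) \/ val e = (j, i).
Proof.
rewrite neq_ltn => /orP[] h.
- by exists (Sub (i, j) h); left; rewrite SubK.
- by exists (Sub (j, i) h); right; rewrite SubK.
Qed.

Definition on_upair e i j := (val e == (i, j)) || (val e == (j, i)).

Lemma pmadj_diag g i : X g i i = 0.
Proof. by rewrite mxE eqxx. Qed.

Lemma pmadjC g i j : X g i j = X g j i.
Proof. by rewrite !mxE eq_sym edgebC. Qed.

Lemma pmadj_sym g : (X g)^T = X g.
Proof. by apply/matrixP=> i j; rewrite mxE pmadjC. Qed.

Lemma pmadj_sqr g i j : X g i j ^+ 2 = (i != j)%:R.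
Proof. by rewrite mxE; case: eqP => _; rewrite ?expr0n //; case: ifP; rewrite ?sqrrN expr1n. Qed.

Lemma pmadj_edge g i j : i != j -> X g i j = 2 * (edgeb g i j)%:R - 1.
Proof. by move=> ij; rewrite mxE (negPf ij); case: edgeb; rewrite /= ?mulr1 ?mulr0; ring. Qed.

Lemma pmadj_flip e g i j :
  X (flip e g) i j = if on_upair e i j then - X g i j else X g i j.
Proof.
have main e' : X (flip e g) (val e').1 (val e').2 =
    if e == e' then - X g (val e').1 (val e').2 else X g (val e').1 (val e').2.
  rewrite !mxE !edgeb_upair ffunE (eq_sym e').
  have -> : ((val e').1 == (val e').2) = false.
    by apply/eqP => h; have := upair_lt e'; rewrite h ltnn.
  by have [<-|ne //] := eqVneq e e'; case: (g e) => /=; rewrite ?opprK.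
have [<-|ij] := eqVneq i j.
  by rewrite !pmadj_diag oppr0 if_same.
have anti e1 e2 k l : val e1 = (k, l) -> val e2 = (l, k) -> False.
  move=> h1 h2; have := upair_lt e1; have := upair_lt e2; rewrite h1 h2 /= => a b.
  by have := ltn_trans a b; rewrite ltnn.
have [e' [h|h]] := upairP ij.
  have := main e'; rewrite h /= => ->; rewrite /on_upair -h (inj_eq val_inj).
  by have [//|ne] := eqVneq e e'; case: eqP => //= /(anti _ _ _ _ h).
rewrite pmadjC [in RHS]pmadjC.
have := main e'; rewrite h /= => ->; rewrite /on_upair orbC -h (inj_eq val_inj).
by have [//|ne] := eqVneq e e'; case: eqP => //= /(anti _ _ _ _ h).
Qed.

Definition graph_compl g : graph n := [ffun e => ~~ g e].

Lemma graph_complK : involutive graph_compl.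
Proof. by move=> g; apply/ffunP => e; rewrite !ffunE negbK. Qed.

Lemma pmadj_compl g : X (graph_compl g) = - X g.
Proof.
apply/matrixP=> i j; rewrite [RHS]mxE.
have [<-|ij] := eqVneq i j; first by rewrite !pmadj_diag oppr0.
have main e : X (graph_compl g) (val e).1 (val e).2 = - X g (val e).1 (val e).2.
  rewrite !mxE !edgeb_upair ffunE.
  have -> : ((val e).1 == (val e).2) = false.
    by apply/eqP => h; have := upair_lt e; rewrite h ltnn.
  by case: (g e) => /=; rewrite ?opprK.
have [e [h|h]] := upairP ij; first by have := main e; rewrite h.
by rewrite pmadjC [in RHS]pmadjC; have := main e; rewrite h.
Qed.

(** Turns the sum over edges in the Poincare inequality into a sum over all matrix entries, that is,
    into a Frobenius norm. *)
Lemma sum_upair_le (f : 'I_n -> 'I_n -> R) : (forall i j, 0 <= f i j) ->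
  \sum_(e : upair n) f (val e).1 (val e).2 <= \sum_i \sum_j f i j.
Proof.
move=> f0; rewrite pair_big /=.
have -> : \sum_(e : upair n) f (val e).1 (val e).2 =
    \sum_(p in [set val e | e in [set: upair n]]) f p.1 p.2.
  rewrite big_imset /=; first by apply: eq_bigl => e; rewrite inE.
  by move=> ? ? _ _; exact: val_inj.
by rewrite big_mkcond; apply: ler_sum => p _; case: ifP.
Qed.

Lemma pmadj_flip_diff e g i j :
  (X (flip e g) - X g) i j = if on_upair e i j then - (2 * X g i j) else 0.
Proof. by rewrite mxE [X in _ + X]mxE pmadj_flip; case: ifP => _; ring. Qed.

(* [X (flip e g) - X g] is supported on the two positions of [e]. *)
Lemma mxtrace_mul_flip (M : 'M[R]_n) e g : M^T = M ->
  \tr (M *m (X (flip e g) - X g)) = - 4 * (X g (val e).1 (val e).2 * M (val e).1 (val e).2).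
Proof.
move=> Ms; set D := _ - _.
have lt := upair_lt e; case eE : (val e) lt => [k l] /= kl.
have -> : \tr (M *m D) = \sum_p M p.1 p.2 * D p.2 p.1.
  by rewrite -(pair_big xpredT xpredT (fun i j => M i j * D j i)); apply: eq_bigr => i _; rewrite mxE.
have kl' : (l, k) != (k, l) by apply/eqP => -[h _]; rewrite h ltnn in kl.
rewrite (bigD1 (k, l)) //= (bigD1 (l, k)) //= big1 ?addr0; last first.
  move=> [i j] /andP[h1 h2]; rewrite /D pmadj_flip_diff /on_upair eE /=.
  rewrite (eq_sym _ (i, j)) (negPf h1) orbF.
  have -> : ((k, l) == (j, i)) = false by apply/eqP => -[e1 e2]; rewrite e1 e2 eqxx in h2.
  by rewrite mulr0.
have Mlk : M l k = M k l by rewrite -[in LHS]Ms mxE.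
rewrite /D !pmadj_flip_diff /on_upair eE !eqxx orbT /= Mlk (pmadjC g l).
by ring.
Qed.

(** The difference has two nonzero entries, both equal to 2 or -2. *)
Lemma mxtrace_flip_sqr e g :
  \tr ((X (flip e g) - X g) *m (X (flip e g) - X g)) = 8.
Proof.
rewrite mxtrace_mul_flip; last by rewrite linearB /= !pmadj_sym.
rewrite pmadj_flip_diff /on_upair -surjective_pairing eqxx /=.
have := pmadj_sqr g (val e).1 (val e).2.
rewrite (_ : (_ != _) = true); last by apply/eqP => h; have := upair_lt e; rewrite h ltnn.
set x := X g _ _ => h; have -> : -4 * (x * - (2 * x)) = 8 * x ^+ 2 by ring.
by rewrite h mulr1.
Qed.

Lemma mxtrace_mul_sym (M : 'M[R]_n) : M^T = M -> \tr (M *m M) = \sum_i \sum_j M i j ^+ 2.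
Proof.
move=> Ms; apply: eq_bigr => i _; rewrite mxE; apply: eq_bigr => j _.
by rewrite -[in X in _ * X]Ms mxE.
Qed.

Lemma mxtrace_pmadj_sqr g : \tr (X g *m X g) = (n * n.-1)%:R.
Proof.
rewrite mxtrace_mul_sym ?pmadj_sym // natrM mulr_natl.
rewrite -[X in _ *+ X](card_ord n) -sumr_const; apply: eq_bigr => i _.
rewrite (bigD1 i) //= pmadj_sqr eqxx add0r.
rewrite (eq_bigr (fun=> 1)) => [|j]; last by rewrite pmadj_sqr eq_sym => ->.
rewrite sumr_const; congr (_%:R).
have := cardC1 i; rewrite card_ord => <-; exact: eq_card.
Qed.

End Graph.

(** * Linear eigenvalue statistics and their second moment *)

Section LinearStatistics.
Variables (R : realType) (n : nat).
Implicit Types (g : graph n) (e : upair n) (f : R -> R) (L : R).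
Local Notation X := (pmadj R).

Lemma pmadj_spectral g : exists p : 'M[R]_n * ('I_n -> R),
  p.1^T *m p.1 = 1%:M /\ X g = specmx p.1 p.2.
Proof.
have [U [a [UU Ua]]] := symmetric_spectral (pmadj_sym R g).
exists (U, fun k => a 0 k); split => //=; rewrite specmx_mul Ua.
by congr (_ *m diag_mx _ *m _); apply/rowP=> k; rewrite mxE.
Qed.

(** One arbitrary, unordered eigendecomposition per graph; [linstatE] shows that [linstat] does not
    depend on this choice when [f] satisfies [taylor2]. *)
Definition eigs g := sval (cid (pmadj_spectral g)).

Definition linstat f g := \sum_k f ((eigs g).2 k).

Definition taylor2 L f (f' : R -> R) := forall x y, `|f y - f x - f' x * (y - x)| <= L * (y - x) ^+ 2.

(** Two decompositions of the same matrix differ by [D = 0], and Klein's inequality then leaves no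
    room between the two sums. No matching of eigenvalues with multiplicity is required. *)
Lemma linstatE L f f' g U a : taylor2 L f f' -> U^T *m U = 1%:M -> X g = specmx U a ->
  linstat f g = \sum_k f (a k).
Proof.
move=> ft UU XE; rewrite /linstat /eigs; case: cid => -[V b] /= [VV XV].
have := @mxtrace_taylor R n f f' L U V a b 0 ft UU VV.
rewrite -XE -XV subrr => /(_ erefl); rewrite mulmx0 mxtrace0 subr0 mulmx0 mxtrace0 mulr0.
by rewrite normr_le0 subr_eq0 => /eqP.
Qed.

Lemma linstat_compl L f f' g : taylor2 L f f' -> (forall x, f (- x) = - f x) ->
  linstat f (graph_compl g) = - linstat f g.
Proof.
move=> ft fodd; have [[U a] /= [UU XE]] := pmadj_spectral g.
rewrite (linstatE ft UU XE) (linstatE (a := fun k => - a k) ft UU).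
  by rewrite -sumrN; apply: eq_bigr => k _; rewrite fodd.
rewrite pmadj_compl XE -sumrN; apply: eq_bigr => k _.
by rewrite scaleNr.
Qed.

Lemma linstat_sum0 L f f' : taylor2 L f f' -> (forall x, f (- x) = - f x) ->
  \sum_g linstat f g = 0.
Proof.
move=> ft fodd; set s := \sum_g _; suff : s = - s by lra.
rewrite {1}/s (reindex_inj (inv_inj (@graph_complK n))) -sumrN.
by apply: eq_bigr => g _; rewrite (linstat_compl _ ft).
Qed.

(** By Klein's inequality the increment is [- 4 x m] up to [8 L], where [x] is the flipped entry and
    [m] the corresponding entry of [f'(X)]. Then [(u + v)^2 <= 2 u^2 + 2 v^2] gives 32 and 128. *)
Lemma linstat_flip L f f' e g : taylor2 L f f' ->
  (linstat f (flip e g) - linstat f g) ^+ 2 <=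
  32 * specmx (eigs g).1 (fun k => f' ((eigs g).2 k)) (val e).1 (val e).2 ^+ 2 + 128 * L ^+ 2.
Proof.
move=> ft; rewrite /linstat.
have [VV XV] := svalP (cid (pmadj_spectral (flip e g))).
have [UU XU] := svalP (cid (pmadj_spectral g)).
rewrite -/(eigs g) -/(eigs (flip e g)) in UU XU VV XV.
have DE : X (flip e g) - X g = specmx (eigs (flip e g)).1 (eigs (flip e g)).2
    - specmx (eigs g).1 (eigs g).2 by congr (_ - _).
have := mxtrace_taylor ft UU VV DE.
rewrite mxtrace_flip_sqr mxtrace_mul_flip ?specmx_sym //.
set s := \sum_l _; set t := \sum_l _; set m := specmx _ _ _ _; set x := X g _ _.
have x2 : x ^+ 2 = 1.
  rewrite pmadj_sqr (_ : (_ != _) = true) //.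
  by apply/eqP => h; have := upair_lt e; rewrite h ltnn.
rewrite ler_norml => /andP[h1 h2].
have m2 : (x * m) ^+ 2 = m ^+ 2 by rewrite exprMn x2 mul1r.
rewrite -m2; move: (x * m) h1 h2 => y h1 h2.
have a1 : 0 <= 8 * L - (s - t + 4 * y) by lra.
have a2 : 0 <= 8 * L + (s - t + 4 * y) by lra.
(* The product states that the remainder [s - t + 4 y] has square at most [64 L^2]; the square is
   the slack in [(u + v)^2 <= 2 u^2 + 2 v^2]. *)
have := mulr_ge0 a1 a2; have := sqr_ge0 (s - t + 8 * y); nra.
Qed.

(** The Frobenius norm of [f'(X)] is at most [L] times that of [X], hence at most [L n]. The factor
    40 is [(32 + 128) / 4]. *)
Theorem linstat_second_moment L f f' : taylor2 L f f' -> (forall x, f (- x) = - f x) ->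
  (forall x, `|f' x| <= L * `|x|) ->
  \sum_g linstat f g ^+ 2 <= 40 * L ^+ 2 * n%:R ^+ 2 * #|{: graph n}|%:R.
Proof.
move=> ft fodd f'L.
apply: le_trans (cube_poincare (linstat_sum0 ft fodd)) _.
rewrite exchange_big /= mulr_sumr mulr_natr -sumr_const; apply: ler_sum => g _.
set M := specmx (eigs g).1 (fun k => f' ((eigs g).2 k)).
have [UU XU] := svalP (cid (pmadj_spectral g)); rewrite -/(eigs g) in UU XU.
have H : \sum_e (linstat f (flip e g) - linstat f g) ^+ 2 <=
   \sum_i \sum_j (32 * M i j ^+ 2 + 128 * L ^+ 2).
  apply: le_trans (ler_sum _ (fun e _ => linstat_flip e g ft)) _.
  apply: sum_upair_le => i j.
  by rewrite addr_ge0 // mulr_ge0 ?sqr_ge0.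
have trM : \sum_i \sum_j M i j ^+ 2 <= L ^+ 2 * n%:R ^+ 2.
  rewrite -mxtrace_mul_sym ?specmx_sym // specmxM // mxtrace_specmx //.
  apply: (@le_trans _ _ (L ^+ 2 * \tr (X g *m X g))); last first.
    rewrite ler_wpM2l ?sqr_ge0 // mxtrace_pmadj_sqr -natrX ler_nat leq_mul2l leq_pred orbT.
    by [].
  rewrite XU specmxM // mxtrace_specmx // mulr_sumr; apply: ler_sum => k _.
  rewrite -!expr2 -exprMn -(real_normK (num_real (f' _))) -[leRHS]real_normK ?num_real //.
  rewrite lerXn2r ?nnegrE // normrM (le_trans (f'L _)) // ler_wpM2r // ler_norm.
  by [].
have E : \sum_i \sum_j (32 * M i j ^+ 2 + 128 * L ^+ 2)
   = 32 * \sum_i \sum_j M i j ^+ 2 + 128 * L ^+ 2 * n%:R ^+ 2.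
  rewrite mulr_sumr.
  under eq_bigr => i _ do rewrite big_split /= -mulr_sumr sumr_const card_ord.
  by rewrite big_split /= sumr_const card_ord -mulrnA -[X in _ + X]mulr_natr natrM; ring.
rewrite E in H; lra.
Qed.

End LinearStatistics.

(** * Row sums *)

Section RowSums.
Variables (R : realType) (n : nat).
Implicit Types (g : graph n) (e : upair n) (i j : 'I_n).
Local Notation X := (pmadj R).

Definition rowsum g i := \sum_j X g i j.

Lemma rowsum_flip e g i j : on_upair e i j ->
  rowsum (flip e g) i = rowsum g i - 2 * X g i j.
Proof.
move=> eij; rewrite /rowsum (bigD1 j) //= [in RHS](bigD1 j) //= pmadj_flip eij.
rewrite (eq_bigr (fun k => X g i k)); first by ring.
move=> k kj; rewrite pmadj_flip; case: ifP => // eik; exfalso.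
move: eij eik; rewrite /on_upair => /orP[] /eqP -> /orP[] /eqP.
- by move=> -[ejk]; rewrite ejk eqxx in kj.
- by move=> -[e1 e2]; rewrite -e1 e2 eqxx in kj.
- by move=> -[e1 e2]; rewrite -e2 e1 eqxx in kj.
- by move=> -[ejk]; rewrite ejk eqxx in kj.
Qed.

Lemma rowsum_flip_out e g i : i != (val e).1 -> i != (val e).2 ->
  rowsum (flip e g) i = rowsum g i.
Proof.
move=> i1 i2; apply: eq_bigr => j _; rewrite pmadj_flip; case: ifP => //.
rewrite /on_upair => /orP[] /eqP h; move: i1 i2; rewrite h ?eqxx //=.
Qed.

(** Flipping the edge [{i, j}] negates [X_ij] and shifts the row sum by [- 2 X_ij], so the sum [s]
    satisfies [s = - s + 2 N] with [N] the number of graphs. *)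
Lemma sum_rowsum_mul i j : i != j ->
  \sum_g rowsum g i * X g i j = \sum_(g : graph n) 1.
Proof.
move=> ij; have [e eij] : exists e, on_upair e i j.
  have [e [h|h]] := upairP ij; exists e; rewrite /on_upair h eqxx ?orbT //.
set s := \sum_g _; suff : s = - s + 2 * \sum_(g : graph n) 1 by lra.
rewrite {1}/s -(sum_flip e) -sumrN mulr_sumr -big_split; apply: eq_bigr => g _ /=.
rewrite (rowsum_flip g eij) pmadj_flip eij.
have := pmadj_sqr R g i j; rewrite ij /= => h.
by rewrite -[X in _ = _ + 2 * X]h; ring.
Qed.

Lemma sum_rowsum_sqr :
  \sum_g \sum_i rowsum g i ^+ 2 = (n * n.-1)%:R * #|{: graph n}|%:R.
Proof.
rewrite exchange_big /=.
transitivity (\sum_(i < n) (n.-1%:R * #|{: graph n}|%:R : R)); last first.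
  by rewrite sumr_const card_ord natrM -mulrA [RHS]mulr_natl.
apply: eq_bigr => i _.
have <- : #|predC1 i| = n.-1 by rewrite cardC1 card_ord.
rewrite mulr_natl -sumr_const.
have E g : rowsum g i ^+ 2 = \sum_(j | j != i) rowsum g i * X g i j.
  rewrite expr2 [X in _ * X = _](bigD1 i) //= pmadj_diag add0r mulr_sumr.
  by apply: eq_bigr.
under eq_bigr => g _ do rewrite E.
rewrite exchange_big /=; apply: eq_big => [j|j ji]; first by rewrite !inE.
by rewrite sum_rowsum_mul 1?eq_sym // sumr_const.
Qed.

(** This is [|X 1|^2] minus its mean. *)
Definition rowstat g := \sum_i rowsum g i ^+ 2 - (n * n.-1)%:R.

Lemma rowstat_sum0 : \sum_g rowstat g = 0.
Proof.
rewrite sumrB sum_rowsum_sqr sumr_const mulr_natr.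
by rewrite subrr.
Qed.

(** Only the two row sums [u], [v] at the ends of [e] move, and the increment is [8 - 4 x (u + v)]
    with [x] the old entry. *)
Lemma rowstat_flip e g : (rowstat (flip e g) - rowstat g) ^+ 2 <=
  128 + 64 * rowsum g (val e).1 ^+ 2 + 64 * rowsum g (val e).2 ^+ 2.
Proof.
case eE : (val e) (upair_lt e) => [k l] /= kl.
have kl' : l != k by apply/eqP => h; rewrite h ltnn in kl.
have ekl : on_upair e k l by rewrite /on_upair eE eqxx.
have elk : on_upair e l k by rewrite /on_upair eE eqxx orbT.
have -> : rowstat (flip e g) - rowstat g =
    \sum_i (rowsum (flip e g) i ^+ 2 - rowsum g i ^+ 2).
  by rewrite sumrB /rowstat; ring.
rewrite (bigD1 k) //= (bigD1 l) //= big1 ?addr0; last first.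
  by move=> i /andP[ik il]; rewrite rowsum_flip_out ?eE ?subrr.
rewrite (rowsum_flip g ekl) (rowsum_flip g elk) (pmadjC _ g l).
have := pmadj_sqr R g k l; rewrite eq_sym kl' /=.
move: (X g k l) (rowsum g k) (rowsum g l) => x u v x2.
have -> : (u - 2 * x) ^+ 2 - u ^+ 2 + ((v - 2 * x) ^+ 2 - v ^+ 2)
   = 8 - 4 * (x * (u + v)).
  by transitivity (8 * x ^+ 2 - 4 * (x * (u + v))); [ring | rewrite x2 mulr1].
have : (x * (u + v)) ^+ 2 <= 2 * u ^+ 2 + 2 * v ^+ 2.
  by rewrite exprMn x2 mul1r; have := sqr_ge0 (u - v); nra.
move: (x * (u + v)) => y hy; have := sqr_ge0 (8 + 4 * y); nra.
Qed.

Lemma rowstat_second_moment :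
  \sum_g rowstat g ^+ 2 <= 64 * n%:R ^+ 3 * #|{: graph n}|%:R.
Proof.
apply: le_trans (cube_poincare rowstat_sum0) _; rewrite exchange_big /=.
apply: (@le_trans _ _ (4^-1 * \sum_(g : graph n)
    (128 * n%:R ^+ 2 + 128 * n%:R * \sum_i rowsum g i ^+ 2))).
  rewrite ler_wpM2l //; apply: ler_sum => g _.
  apply: le_trans (ler_sum _ (fun e _ => rowstat_flip e g)) _.
  apply: le_trans (sum_upair_le (f := fun i j =>
      128 + 64 * rowsum g i ^+ 2 + 64 * rowsum g j ^+ 2) _) _.
    by move=> i j; rewrite !addr_ge0 // mulr_ge0 ?sqr_ge0.
  set S := \sum_i rowsum g i ^+ 2.
  have inner i : \sum_j (128 + 64 * rowsum g i ^+ 2 + 64 * rowsum g j ^+ 2) =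
      n%:R * (128 + 64 * rowsum g i ^+ 2) + 64 * S.
    by rewrite big_split /= sumr_const card_ord -mulr_sumr; congr (_ + _); rewrite [RHS]mulr_natl.
  under eq_bigr => i _ do rewrite inner.
  rewrite big_split /= sumr_const card_ord -mulr_sumr big_split /= sumr_const card_ord.
  rewrite -mulr_sumr -/S -[128 *+ n]mulr_natl -[(64 * S) *+ n]mulr_natl.
  by rewrite le_eqVlt; apply/orP; left; apply/eqP; ring.
rewrite big_split /= sumr_const -[X in X + _]mulr_natl -mulr_sumr sum_rowsum_sqr.
have : (n * n.-1)%:R <= n%:R ^+ 2 :> R by rewrite -natrX ler_nat leq_mul2l leq_pred orbT.
have : n%:R ^+ 2 <= n%:R ^+ 3 :> R.
  by rewrite -!natrX ler_nat; case: (n) => // k; rewrite leq_pexp2l.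
have : 0 <= n%:R :> R by [].
have : 0 <= #|{: graph n}|%:R :> R by [].
move: (#|_|%:R : R) (n%:R : R) ((n * n.-1)%:R : R) => N x p N0 x0 x23 px.
have h1 : N * x ^+ 2 <= N * x ^+ 3 by rewrite ler_wpM2l.
have h2 : (N * x) * p <= (N * x) * x ^+ 2 by rewrite ler_wpM2l ?mulr_ge0.
by rewrite -subr_ge0; move: h1 h2; rewrite -subr_ge0 => h1; rewrite -subr_ge0 => h2; lra.
Qed.

End RowSums.

(** * Truncations of x |x| *)

Section TestFunctions.
Variable R : realType.
Implicit Types x y b : R.

Definition sqrs x := x * `|x|.

Lemma sqrsN x : sqrs (- x) = - sqrs x.
Proof. by rewrite /sqrs normrN mulNr. Qed.

Lemma sqrs_taylor2 : taylor2 1 sqrs (fun x => 2 * `|x|).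
Proof.
move=> x y; rewrite /sqrs ler_norml.
have s1 := sqr_ge0 x; have s2 := sqr_ge0 y; have s3 := sqr_ge0 (y - x).
case: (ger0P x) => [hx|/ltW hx]; case: (ger0P y) => [hy|/ltW hy].
- by apply/andP; split; lra.
- by have := mulr_ge0_le0 hx hy; move=> ?; apply/andP; split; lra.
- by have := mulr_le0_ge0 hx hy; move=> ?; apply/andP; split; lra.
- by apply/andP; split; lra.
Qed.

Lemma taylor2W (L L' : R) f f' : L <= L' -> taylor2 L f f' -> taylor2 L' f f'.
Proof.
by move=> LL ft x y; rewrite (le_trans (ft x y)) // ler_wpM2r ?sqr_ge0.
Qed.

(* The odd function equal to [x ^+ 2] on [[0, b]], with slope [2 * (2 * b - x)] on
   [[b, 2 * b]] and constant beyond. *)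
Definition clip b x :=
  sqrs x - sqrs (x - b) - sqrs (x + b) + (sqrs (x - 2 * b) + sqrs (x + 2 * b)) / 2.

Definition clip' b x :=
  2 * (`|x| - `|x - b| - `|x + b| + (`|x - 2 * b| + `|x + 2 * b|) / 2).

(** [clip] combines five translates of [sqrs], and the absolute values of the coefficients add up to
    [1 + 1 + 1 + 1/2 + 1/2 = 4]. *)
Lemma clip_taylor2 b : taylor2 4 (clip b) (clip' b).
Proof.
move=> x y.
have E c : `|sqrs (y + c) - sqrs (x + c) - 2 * `|x + c| * (y - x)| <= (y - x) ^+ 2.
  have := sqrs_taylor2 (x + c) (y + c).
  by rewrite (_ : y + c - (x + c) = y - x) ?mul1r //; ring.
have := E 0; have := E (- b); have := E b; have := E (- (2 * b)); have := E (2 * b).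
rewrite !addr0 /clip /clip' !ler_norml.
move: (sqrs _) (sqrs (y + _)) (sqrs (y - _)) (sqrs (y + _)) (sqrs (y - _)).
move=> a1 a2 a3 a4 a5.
move=> /andP[? ?] /andP[? ?] /andP[? ?] /andP[? ?] /andP[? ?].
by apply/andP; split; nra.
Qed.

Lemma clipN b x : clip b (- x) = - clip b x.
Proof.
have E c : sqrs (- x + c) = - sqrs (x - c) by rewrite -sqrsN; congr sqrs; ring.
by rewrite /clip sqrsN !E !opprK; ring.
Qed.

Lemma clip'_bound b x : 0 <= b -> `|clip' b x| <= 4 * `|x|.
Proof.
move=> b0; rewrite /clip' ler_norml.
case: (ger0P x) => h1; case: (ger0P (x - b)) => h2; case: (ger0P (x + b)) => h3;
case: (ger0P (x - 2 * b)) => h4; case: (ger0P (x + 2 * b)) => h5;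
by apply/andP; split; lra.
Qed.

Lemma clip_ge0 b x : 0 <= b -> 0 <= x -> 0 <= clip b x <= 2 * b ^+ 2.
Proof.
move=> b0 x0; rewrite /clip /sqrs.
have h3 : 0 <= x + b by lra. have h5 : 0 <= x + 2 * b by lra.
rewrite (ger0_norm x0) (ger0_norm h3) (ger0_norm h5).
case: (ger0P (x - b)) => h2; case: (ger0P (x - 2 * b)) => h4;
by apply/andP; split; nra.
Qed.

Lemma clip_norm b x : 0 <= b -> `|clip b x| <= 2 * b ^+ 2.
Proof.
move=> b0; case: (lerP 0 x) => x0.
  by have /andP[h1 h2] := clip_ge0 b0 x0; rewrite ger0_norm.
have nx0 : 0 <= - x by lra.
have /andP[h1 h2] := clip_ge0 b0 nx0.
by rewrite -normrN -clipN ger0_norm.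
Qed.

Lemma clip_sat b x : 0 <= b -> 2 * b <= x -> clip b x = 2 * b ^+ 2.
Proof.
move=> b0 xb; by rewrite /clip /sqrs !ger0_norm; lra.
Qed.

End TestFunctions.

(** * Splitting the spectrum at the median *)

Section MedianSplit.
Variables (R : realType) (n : nat).
Hypothesis n_even : ~~ odd n.
Implicit Types (lam : 'I_n -> R) (t : R).

Definition half_gap lam : R :=
  \sum_(k < n | (k < n./2)%N) lam k ^+ 2 - \sum_(k < n | (n./2 <= k)%N) lam k ^+ 2.

Lemma split_half (F : 'I_n -> R) :
  \sum_k F k = \sum_(k < n | (k < n./2)%N) F k + \sum_(k < n | (n./2 <= k)%N) F k.
Proof.
rewrite (bigID (fun k : 'I_n => (k < n./2)%N)) /=; congr (_ + _).
by apply: eq_bigl => k; rewrite -leqNgt.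
Qed.

Lemma rev_ord_half (k : 'I_n) : (rev_ord k < n./2)%N = (n./2 <= k)%N.
Proof.
have := ltn_ord k; have := odd_double_half n; rewrite (negPf n_even) /= -addnn => nE kn.
apply/idP/idP => h; move: h; rewrite /=; lia.
Qed.

Lemma sum_rev_half (F : 'I_n -> R) :
  \sum_(k < n | (k < n./2)%N) F (rev_ord k) = \sum_(k < n | (n./2 <= k)%N) F k.
Proof.
rewrite [LHS](reindex_inj rev_ord_inj) /=; apply: eq_big => [k|k _].
  exact: rev_ord_half.
by rewrite rev_ordK.
Qed.

(* The eigenvalues of the lower half that are still positive are the only obstruction.
   Since [clip b] saturates on the upper half, their squares are dominated by the linear
   statistic of [clip b], where [b] is the dyadic scale of the median eigenvalue. *)
Lemma half_gap_lower lam t :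
  (forall k l : 'I_n, (k <= l)%N -> lam l <= lam k) ->
  (forall k, `|lam k| <= n%:R) ->
  `|\sum_k sqrs (lam k)| <= t ->
  (forall j, (2 ^ j.+1 <= n)%N -> `|\sum_k clip (2 ^+ j) (lam k)| <= t) ->
  - (17 * t + 8 * n%:R) <= half_gap lam.
Proof.
move=> mono lamn hphi hclip.
have t0 : 0 <= t by apply: le_trans hphi.
have n0 : 0 <= n%:R :> R by [].
pose Q := \sum_(k < n | (n./2 <= k)%N) (if 0 < lam k then lam k ^+ 2 else 0).
(* Upper half: [sqrs x <= x^2]. Lower half: [sqrs x = - x^2] except at the positive eigenvalues,
   where the sign is corrected by twice the term of [Q]. *)
have gapQ : \sum_k sqrs (lam k) - 2 * Q <= half_gap lam.
  rewrite split_half /half_gap /Q mulr_sumr -addrA -sumrB lerD //.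
    apply: ler_sum => k _; rewrite /sqrs expr2.
    by case: (ger0P (lam k)) => h; nra.
  rewrite -sumrN; apply: ler_sum => k _; rewrite /sqrs expr2.
  by case: ltrP => h; [rewrite gtr0_norm // | rewrite ler0_norm //]; lra.
suff : Q <= 8 * t + 4 * n%:R.
  by move: hphi; rewrite ler_norml => /andP[h1 h2] h3; lra.
(* For [n = 0] there is no median index and the lower half is empty. Otherwise [a] is the largest
   eigenvalue of the lower half. *)
have [mn|nm] := ltnP n./2 n; last first.
  rewrite /Q big1 ?addr_ge0 ?mulr_ge0 // => k kn.
  by have := leq_trans nm kn; rewrite leqNgt ltn_ord.
set a := lam (Ordinal mn).
have low (k : 'I_n) : (n./2 <= k)%N -> lam k <= a by move=> h; apply: mono.
have up (k : 'I_n) : (k < n./2)%N -> a <= lam k by move=> h; apply: mono; rewrite /= ltnW.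
have [a0|a0] := lerP a 0.
  rewrite /Q big1 ?addr_ge0 ?mulr_ge0 // => k kn.
  by rewrite ltNge (le_trans (low _ kn)).
have [a2|a2] := ltrP a 2.
  apply: (@le_trans _ _ (\sum_(k < n) 4)).
    rewrite split_half -[leLHS]add0r lerD ?sumr_ge0 //; apply: ler_sum => k kn.
    by case: ltrP => // h; have := low k kn; nra.
  by rewrite sumr_const card_ord -mulr_natr; lra.
(* With [b = 2^j] this is [2 b <= a < 4 b]: the upper half lies where [clip b] is saturated, and [a]
   exceeds the scale by a bounded factor only. The bound [a <= n] keeps the number of scales
   logarithmic. *)
have [j [jn ja aj]] : exists j, [/\ (2 ^ j.+1 <= n)%N, 2 * 2 ^+ j <= a & a < 4 * 2 ^+ j :> R].
  pose q := Num.trunc a.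
  have /andP[qa aq] : q%:R <= a < q.+1%:R by apply: truncn_itv; exact: ltW.
  have q2 : (2 <= q)%N by rewrite -ltnS -(ltr_nat R) (le_lt_trans a2).
  have qn : (q <= n)%N.
    rewrite -(ler_nat R); apply: le_trans qa _; apply: le_trans (lamn (Ordinal mn)).
    exact: ler_norm.
  have l1 := trunc_log_bounds (isT : (1 < 2)%N) (ltnW q2).
  have l0 : (0 < trunc_log 2 q)%N by rewrite trunc_log_gt0.
  case E : (trunc_log 2 q) l0 l1 => [//|j] _ /andP[l1 l2].
  exists j; split.
  - exact: leq_trans l1 qn.
  - by rewrite -exprS -natrX (le_trans _ qa) // ler_nat.
  - apply: lt_le_trans aq _; rewrite (_ : 4 = 2 ^+ 2) -?exprD; last by ring.
    by rewrite -natrX ler_nat.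
set b : R := 2 ^+ j in ja aj; have b0 : 0 <= b by rewrite exprn_ge0.
(* Each lower eigenvalue is paired with an upper one, which contributes [2 b^2]; this uses that [n]
   is even. A pair never sums below 0, and if the lower member is positive it sums to at least
   [2 b^2], while the square of that member is at most [16 b^2]. *)
have hQ : Q <= 8 * \sum_k clip b (lam k).
  rewrite split_half (eq_bigr (fun=> 2 * b ^+ 2)) => [|k kn]; last first.
    by apply: clip_sat => //; apply: le_trans ja (up _ kn).
  rewrite (sum_rev_half (fun=> 2 * b ^+ 2)) -big_split mulr_sumr.
  apply: ler_sum => k kn /=.
  have := clip_norm (lam k) b0; rewrite ler_norml => /andP[c1 c2].
  case: ltrP => h; last by lra.
  have /andP[c3 c4] := clip_ge0 b0 (ltW h).
  by have := low k kn; nra.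
have := hclip j jn; rewrite -/b ler_norml => /andP[_ h2].
lra.
Qed.

(** The upper bound is the lower bound for the spectrum of [- X]: negating and reversing [lam]
    exchanges the halves and negates every odd statistic. *)
Lemma half_gap_bound lam t :
  (forall k l : 'I_n, (k <= l)%N -> lam l <= lam k) ->
  (forall k, `|lam k| <= n%:R) ->
  `|\sum_k sqrs (lam k)| <= t ->
  (forall j, (2 ^ j.+1 <= n)%N -> `|\sum_k clip (2 ^+ j) (lam k)| <= t) ->
  `|half_gap lam| <= 17 * t + 8 * n%:R.
Proof.
move=> mono lamn hphi hclip.
have revN (f : R -> R) : (forall x, f (- x) = - f x) ->
    \sum_k f (- lam (rev_ord k)) = - \sum_k f (lam k).
  move=> fodd; rewrite [in RHS](reindex_inj rev_ord_inj) -sumrN.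
  by apply: eq_bigr => k _; rewrite fodd.
have h1 := half_gap_lower mono lamn hphi hclip.
have h2 : - (17 * t + 8 * n%:R) <= half_gap (fun k => - lam (rev_ord k)).
  apply: half_gap_lower => [k l kl|k||j jn].
  - by rewrite lerN2 mono //= leq_sub2l.
  - by rewrite normrN.
  - by rewrite revN ?normrN //; exact: sqrsN.
  - by rewrite revN ?normrN //; [exact: hclip | exact: clipN].
have E : half_gap (fun k => - lam (rev_ord k)) = - half_gap lam.
  rewrite /half_gap opprB (sum_rev_half (fun k => (- lam k) ^+ 2)).
  rewrite -[in X in _ - X = _](sum_rev_half (fun k => (- lam (rev_ord k)) ^+ 2)).
  congr (_ - _); apply: eq_bigr => k _; rewrite ?rev_ordK sqrrN //.
by move: h2; rewrite E ler_norml lerNr opprK => ->; rewrite h1.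
Qed.

End MedianSplit.

(** * Averages over edges and non-edges *)

Section Averages.
Variables (R : realType) (n : nat) (g : graph n).
Local Notation X := (pmadj R g).
Implicit Types (M : 'M[R]_n) (a : 'I_n -> R).

Definition sum_entries M := \sum_i \sum_j M i j.

Lemma sum_edges M :
  \sum_(p : 'I_n * 'I_n | edgeb g p.1 p.2) M p.1 p.2
    = (\tr (X *m M^T) + sum_entries M - \tr M) / 2.
Proof.
have -> : \tr M = \sum_(p : 'I_n * 'I_n) (p.1 == p.2)%:R * M p.1 p.2.
  rewrite -(pair_big xpredT xpredT (fun i j => (i == j)%:R * M i j)) /=.
  apply: eq_bigr => i _; rewrite (bigD1 i) //= eqxx mul1r big1 ?addr0 // => j.
  by rewrite eq_sym => /negPf ->; rewrite mul0r.
have -> : \tr (X *m M^T) = \sum_(p : 'I_n * 'I_n) X p.1 p.2 * M p.1 p.2.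
  rewrite -(pair_big xpredT xpredT (fun i j => X i j * M i j)) /=.
  by apply: eq_bigr => i _; rewrite mxE; apply: eq_bigr => j _; rewrite [M^T _ _]mxE.
rewrite /sum_entries pair_big /= -big_split -sumrB mulr_suml /= big_mkcond.
apply: eq_bigr => -[i j] _ /=; have [<-|ij] := eqVneq i j.
  by rewrite edgebii pmadj_diag /=; field.
by rewrite pmadj_edge //; case: edgeb => /=; field.
Qed.

Lemma sum_nonedges M :
  \sum_(p : 'I_n * 'I_n | ~~ edgeb g p.1 p.2) M p.1 p.2
    = (sum_entries M + \tr M - \tr (X *m M^T)) / 2.
Proof.
have : sum_entries M = \sum_(p : 'I_n * 'I_n | edgeb g p.1 p.2) M p.1 p.2 +
    \sum_(p : 'I_n * 'I_n | ~~ edgeb g p.1 p.2) M p.1 p.2.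
  by rewrite /sum_entries pair_big (bigID (fun p => edgeb g p.1 p.2)).
by rewrite sum_edges => h; lra.
Qed.

Lemma sum_entries_tr M : sum_entries M = \tr (const_mx 1 *m M^T).
Proof.
apply: eq_bigr => i _; rewrite mxE; apply: eq_bigr => j _.
by rewrite !mxE mul1r.
Qed.

Lemma card_edges :
  #|[set p : 'I_n * 'I_n | edgeb g p.1 p.2]|%:R = (sum_entries X + n%:R ^+ 2 - n%:R) / 2 :> R.
Proof.
have := sum_edges (const_mx 1).
rewrite (eq_bigr (fun=> 1)) => [|p _]; last by rewrite mxE.
rewrite sumr_const cardsE => ->; congr (_ / 2).
rewrite mxtrace_mulC trmx_const -[X]pmadj_sym -sum_entries_tr pmadj_sym.
have -> : \tr (const_mx 1 : 'M[R]_n) = n%:R.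
  by rewrite /mxtrace (eq_bigr (fun=> 1)) ?sumr_const ?card_ord // => i _; rewrite mxE.
congr (_ + _ - _).
rewrite /sum_entries; under eq_bigr => i _ do under eq_bigr => j _ do rewrite mxE.
by rewrite !sumr_const card_ord expr2 mulr_natl.
Qed.

Lemma card_nonedges :
  #|[set p : 'I_n * 'I_n | ~~ edgeb g p.1 p.2]|%:R = (n%:R ^+ 2 + n%:R - sum_entries X) / 2 :> R.
Proof.
have E : (#|[set p : 'I_n * 'I_n | edgeb g p.1 p.2]| +
   #|[set p : 'I_n * 'I_n | ~~ edgeb g p.1 p.2]|)%N = (n * n)%N.
  have -> : [set p : 'I_n * 'I_n | ~~ edgeb g p.1 p.2] = ~: [set p | edgeb g p.1 p.2].
    by apply/setP=> p; rewrite !inE.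
  by rewrite cardsC card_prod card_ord.
have := congr1 (fun k => k%:R : R) E; rewrite natrD natrM card_edges => h.
lra.
Qed.

Lemma sum_entries_specmx U a : sum_entries (specmx U a) = \sum_k a k * (\sum_i U i k) ^+ 2.
Proof.
rewrite /sum_entries; under eq_bigr => i _ do under eq_bigr => j _ do rewrite specmxE.
under eq_bigr => i _ do rewrite exchange_big.
rewrite exchange_big; apply: eq_bigr => k _ /=.
rewrite expr2 mulr_suml mulr_sumr; apply: eq_bigr => i _.
by rewrite !mulr_sumr.
Qed.

Lemma sum_entries_sqr : sum_entries (X *m X) = \sum_k rowsum R g k ^+ 2.
Proof.
rewrite /sum_entries; under eq_bigr => i _ do under eq_bigr => j _ do rewrite mxE.
under eq_bigr => i _ do rewrite exchange_big.
rewrite exchange_big; apply: eq_bigr => k _ /=.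
rewrite expr2 mulr_suml; apply: eq_bigr => i _.
by rewrite mulr_sumr pmadjC.
Qed.

Lemma sum_entries1 : sum_entries 1%:M = n%:R.
Proof.
rewrite /sum_entries (eq_bigr (fun=> 1)) ?sumr_const ?card_ord // => i _.
rewrite (bigD1 i) //= mxE eqxx big1 ?addr0 // => j ji.
by rewrite mxE eq_sym (negPf ji).
Qed.

Lemma amgm_norm (x s : R) : 0 < s -> `|x| <= x ^+ 2 / (2 * s) + s / 2.
Proof.
move=> s0; rewrite -subr_ge0 -(real_normK (num_real x)); set y := `|x|.
have -> : y ^+ 2 / (2 * s) + s / 2 - y = (y - s) ^+ 2 / (2 * s).
  by field; apply: lt0r_neq0.
by rewrite divr_ge0 ?sqr_ge0 // mulr_ge0 // ltW.
Qed.

(** The left side is a sum of the [a_k] weighted by [<u_k, 1>^2]. With these weights the [lam_k^2]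
    add up to [|X 1|^2] and the constant 1 adds up to [n], so AM-GM on each term suffices; [s] is
    later the square root of [n], which balances the two parts. *)
Lemma sum_entries_specmx_bound U lam a s : 0 < s -> U^T *m U = 1%:M -> X = specmx U lam ->
  (forall k, `|a k| <= `|lam k|) ->
  `|sum_entries (specmx U a)| <= (\sum_k rowsum R g k ^+ 2) / (2 * s) + n%:R * s / 2.
Proof.
move=> s0 UU XE al; rewrite sum_entries_specmx -sum_entries_sqr -sum_entries1 XE specmxM // -(specmx1 UU).
rewrite !sum_entries_specmx !mulr_suml -big_split /=.
apply: le_trans (ler_norm_sum _ _ _) _; apply: ler_sum => k _.
set c := (\sum_i _) ^+ 2; have c0 : 0 <= c by rewrite sqr_ge0.
rewrite normrM (ger0_norm c0) mul1r.
have -> : lam k * lam k * c / (2 * s) + c * s / 2 = (lam k ^+ 2 / (2 * s) + s / 2) * c by ring.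
by rewrite ler_wpM2r // (le_trans (al k)) // amgm_norm.
Qed.

Lemma mxtrace_specmx_bound U lam a s : 0 < s -> U^T *m U = 1%:M -> X = specmx U lam ->
  (forall k, `|a k| <= `|lam k|) ->
  `|\tr (specmx U a)| <= n%:R ^+ 2 / (2 * s) + n%:R * s / 2.
Proof.
move=> s0 UU XE al; rewrite mxtrace_specmx //.
apply: le_trans (ler_norm_sum _ _ _) _.
apply: (@le_trans _ _ (\sum_k (lam k ^+ 2 / (2 * s) + s / 2))).
  by apply: ler_sum => k _; rewrite (le_trans (al k)) // amgm_norm.
rewrite big_split /= sumr_const card_ord -mulr_suml -[X in _ + X]mulr_natl mulrA lerD2r.
have -> : \sum_k lam k ^+ 2 = (n * n.-1)%:R.
  by rewrite -(mxtrace_pmadj_sqr R g) XE specmxM // mxtrace_specmx.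
rewrite ler_wpM2r ?invr_ge0 ?mulr_ge0 ?(ltW s0) //.
by rewrite -natrX ler_nat leq_mul2l leq_pred orbT.
Qed.

End Averages.

(** * Deterministic conclusion from bounds on the statistics, with [s] the square root of [n] *)

Section GoodGraphs.
Variables (R : realType) (n : nat) (g : graph n) (s : R).
Hypotheses (n_even : ~~ odd n) (s5 : 5 <= s) (s2 : s ^+ 2 = n%:R).
Local Notation X := (pmadj R g).

Lemma XplusE lam U : Xplus lam U = specmx U (fun k => if (k < n./2)%N then lam k else 0) :> 'M[R]_n.
Proof.
by rewrite /Xplus big_mkcond; apply: eq_bigr => k _; case: ifP; rewrite ?scale0r.
Qed.

Lemma XminusE lam U : Xminus lam U = specmx U (fun k => if (n./2 <= k)%N then lam k else 0) :> 'M[R]_n.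
Proof.
by rewrite /Xminus big_mkcond; apply: eq_bigr => k _; case: ifP; rewrite ?scale0r.
Qed.

Lemma avgEB (M N : 'M[R]_n) : avgE g (M - N) = avgE g M - avgE g N.
Proof.
rewrite /avgE -mulrBl -sumrB; congr (_ / _).
by apply: eq_bigr => p _; rewrite !mxE.
Qed.

Lemma avgNEB (M N : 'M[R]_n) : avgNE g (M - N) = avgNE g M - avgNE g N.
Proof.
rewrite /avgNE -mulrBl -sumrB; congr (_ / _).
by apply: eq_bigr => p _; rewrite !mxE.
Qed.

Lemma spec_abs_le (lam : 'I_n -> R) U : U^T *m U = 1%:M -> X = specmx U lam ->
  \sum_k lam k ^+ 2 = (n * n.-1)%:R /\ forall k, `|lam k| <= n%:R.
Proof.
move=> UU XE.
have E : \sum_k lam k ^+ 2 = (n * n.-1)%:R.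
  by rewrite -(mxtrace_pmadj_sqr R g) XE specmxM // mxtrace_specmx.
split => // k; rewrite -(ler_pXn2r (n := 2)) ?nnegrE // real_normK ?num_real //.
apply: (@le_trans _ _ (n * n.-1)%:R); last first.
  by rewrite -natrX ler_nat leq_mul2l leq_pred orbT.
rewrite -E (bigD1 k) //= lerDl sumr_ge0 // => l _.
exact: sqr_ge0.
Qed.

Lemma avg_specmx U (lam a : 'I_n -> R) :
  U^T *m U = 1%:M -> X = specmx U lam -> (forall k, `|a k| <= `|lam k|) ->
  \sum_k rowsum R g k ^+ 2 <= 2 * n%:R ^+ 2 ->
  `|\sum_k lam k * a k - n%:R ^+ 2 / 2| <= 13 * s ^+ 3 ->
  `|avgE g (specmx U a) - 2^-1| <= 36 / s /\ `|avgNE g (specmx U a) + 2^-1| <= 36 / s.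
Proof.
move=> UU XE al hrow hsum.
have s0 : 0 < s by apply: lt_le_trans s5.
have s_n0 : s != 0 by rewrite gt_eqF.
have tot (b : 'I_n -> R) : (forall k, `|b k| <= `|lam k|) ->
    `|sum_entries (specmx U b)| <= 3 / 2 * s ^+ 3.
  move=> bl; apply: le_trans (sum_entries_specmx_bound s0 UU XE bl) _.
  have h : (\sum_k rowsum R g k ^+ 2) / (2 * s) <= (2 * n%:R ^+ 2) / (2 * s).
    by rewrite ler_wpM2r ?invr_ge0 ?mulr_ge0 ?(ltW s0).
  apply: le_trans (lerD h (lexx _)) _; rewrite -s2.
  have -> : 2 * s ^+ 2 ^+ 2 / (2 * s) + s ^+ 2 * s / 2 = 3 / 2 * s ^+ 3 by field.
  exact: lexx.
have totX : `|sum_entries X| <= 3 / 2 * s ^+ 3 by rewrite {1}XE; apply: tot.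
have tota := tot a al.
have tra : `|\tr (specmx U a)| <= s ^+ 3.
  apply: le_trans (mxtrace_specmx_bound s0 UU XE al) _; rewrite -s2.
  have -> : s ^+ 2 ^+ 2 / (2 * s) + s ^+ 2 * s / 2 = s ^+ 3 by field.
  exact: lexx.
have trX : \tr (X *m (specmx U a)^T) = \sum_k lam k * a k.
  by rewrite specmx_sym XE specmxM // mxtrace_specmx.
rewrite /avgE /avgNE sum_edges sum_nonedges card_edges card_nonedges trX.
move: hsum tota tra totX; rewrite -s2.
move: (sum_entries (specmx U a)) (\tr _) (\sum_k lam k * a k) (sum_entries X) => A T P Y.
rewrite !ler_norml => /andP[P1 P2] /andP[A1 A2] /andP[T1 T2] /andP[Y1 Y2].
have s23 : 5 * s ^+ 2 <= s ^+ 3 by rewrite [leRHS]exprS ler_wpM2r ?sqr_ge0.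
have s34 : 5 * s ^+ 3 <= s ^+ 4 by rewrite [leRHS]exprS ler_wpM2r ?exprn_ge0 ?(ltW s0).
have s30 : 0 <= s ^+ 3 by rewrite exprn_ge0 ?ltW.
have s20 : 0 <= s ^+ 2 by rewrite exprn_ge0 ?ltW.
have s22 : s ^+ 2 ^+ 2 = s ^+ 4 by rewrite -exprM.
(* Both cardinalities are about [n^2 / 2 = s^4 / 2], and [5 <= s] absorbs the lower-order terms so
   that a quarter of [s^4] remains. The constant is [36 = 9 * 4]. *)
have ratio (u v c : R) : s ^+ 4 / 4 <= v -> `|u - c * v| <= 9 * s ^+ 3 ->
    `|u / v - c| <= 36 / s.
  move=> v4 uv; have v0 : 0 < v by apply: lt_le_trans v4; rewrite divr_gt0 ?exprn_gt0.
  have -> : u / v - c = (u - c * v) / v by field; rewrite gt_eqF.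
  rewrite normrM normfV (gtr0_norm v0) ler_pdivrMr //.
  apply: le_trans uv _.
  have -> : 9 * s ^+ 3 = 36 / s * (s ^+ 4 / 4) by field.
  by rewrite ler_wpM2l // divr_ge0 // ltW.
rewrite s22 in P1 P2 *.
split.
  rewrite -ler_norml; apply: ratio; first by lra.
  by rewrite ler_norml; apply/andP; split; lra.
rewrite -ler_norml -[X in _ + X]opprK; apply: ratio; first by lra.
by rewrite ler_norml; apply/andP; split; lra.
Qed.

Theorem goodA7_of_statistics (b : R) :
  \sum_k rowsum R g k ^+ 2 <= 2 * n%:R ^+ 2 ->
  `|linstat (@sqrs R) g| <= n%:R * s ->
  (forall j, (2 ^ j.+1 <= n)%N -> `|linstat (clip (2 ^+ j)) g| <= n%:R * s) ->
  72 / s <= b -> goodA7 b g.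
Proof.
move=> hrow hphi hclip hb lam U [UU XE mono].
rewrite -/(specmx U lam) in XE; have [lam2 lamn] := spec_abs_le UU XE.
have s0 : 0 < s by apply: lt_le_trans s5.
have s3 : n%:R * s = s ^+ 3 by rewrite exprSr s2.
have gap : `|half_gap lam| <= 17 * (n%:R * s) + 8 * n%:R.
  apply: half_gap_bound => //.
    by rewrite -(linstatE (@sqrs_taylor2 R) UU XE).
  by move=> j jn; rewrite -(linstatE (clip_taylor2 (2 ^+ j)) UU XE); exact: hclip.
have lE (Q : pred 'I_n) : \sum_k lam k * (if Q k then lam k else 0) = \sum_(k | Q k) lam k ^+ 2.
  by rewrite [RHS]big_mkcond; apply: eq_bigr => k _; case: ifP; rewrite ?mulr0.
have al (Q : pred 'I_n) k : `|if Q k then lam k else 0| <= `|lam k|.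
  by case: ifP; rewrite ?normr0.
have s23 : 5 * s ^+ 2 <= s ^+ 3 by rewrite [leRHS]exprS ler_wpM2r ?sqr_ge0.
have nn : (n * n.-1)%:R = s ^+ 2 ^+ 2 - s ^+ 2 :> R.
  rewrite s2; have n0 : (0 < n)%N by rewrite -(ltr_nat R) -s2 exprn_gt0.
  by rewrite natrM -(subn1 n) natrB //; ring.
rewrite split_half in lam2.
move: gap; rewrite /half_gap s3 -s2 ler_norml => /andP[g1 g2].
rewrite nn in lam2.
have [p1 p2] : `|avgE g (Xplus lam U) - 2^-1| <= 36 / s /\
    `|avgNE g (Xplus lam U) + 2^-1| <= 36 / s.
  rewrite XplusE; apply: (avg_specmx UU XE) => //.
    exact: (al (fun k : 'I_n => (k < n./2)%N)).
  rewrite (lE (fun k : 'I_n => (k < n./2)%N)) -s2 ler_norml; apply/andP; split; lra.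
have [m1 m2] : `|avgE g (Xminus lam U) - 2^-1| <= 36 / s /\
    `|avgNE g (Xminus lam U) + 2^-1| <= 36 / s.
  rewrite XminusE; apply: (avg_specmx UU XE) => //.
    exact: (al (fun k : 'I_n => (n./2 <= k)%N)).
  rewrite (lE (fun k : 'I_n => (n./2 <= k)%N)) -s2 ler_norml; apply/andP; split; lra.
have s36 : 72 / s = 36 / s + 36 / s by ring.
have weak (u : R) : `|u| <= 36 / s -> `|u| <= b.
  by move=> /le_trans; apply; apply: le_trans hb; rewrite s36 lerDl divr_ge0 ?(ltW s0).
(* For [Z] the two averages are close to the same value, so their errors add up; hence 72. *)
have near (u v c : R) : `|u - c| <= 36 / s -> `|v - c| <= 36 / s -> `|v - u| <= b.
  move=> uc vc; apply: le_trans (ler_distD c v u) _; apply: le_trans hb.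
  by rewrite s36 (distrC c) lerD.
rewrite /= avgEB avgNEB; do !split; try exact: weak; first exact: near m1.
by apply: (near _ _ (- 2^-1)); rewrite opprK.
Qed.

End GoodGraphs.

(** * Probability estimates *)

Lemma card_cover (T : finType) (J : nat) (G A B : {set T}) (D : 'I_J -> {set T}) :
  (forall g, g \notin A -> g \notin B -> (forall j, g \notin D j) -> g \in G) ->
  (#|T| <= #|G| + (#|A| + #|B| + \sum_j #|D j|))%N.
Proof.
move=> cov; have cardD : (#|\bigcup_j D j| <= \sum_j #|D j|)%N.
  apply: (big_ind2 (fun (S : {set T}) k => #|S| <= k)%N); first by rewrite cards0.
    move=> S1 k1 S2 k2 h1 h2; apply: leq_trans (leq_add h1 h2).
    by rewrite -cardsUI leq_addr.
  by [].
have U (S1 S2 : {set T}) : (#|S1 :|: S2| <= #|S1| + #|S2|)%N by rewrite -cardsUI leq_addr.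
apply: (@leq_trans #|G :|: (A :|: B :|: \bigcup_j D j)|); last first.
  apply: leq_trans (U _ _) _; rewrite leq_add2l; apply: leq_trans (U _ _) _.
  exact: leq_add (U _ _) cardD.
rewrite -cardsT; apply/subset_leq_card/fintype.subsetP => g _; rewrite !inE.
apply/orP; have [gA|gA] := boolP (g \in A); first by right.
have [gB|gB] := boolP (g \in B); first by right; rewrite orbT.
have [gD|gD] := boolP (g \in \bigcup_j D j); first by right; rewrite orbT.
left; apply: cov => // j; apply: contra gD => gj; apply/bigcupP; by exists j.
Qed.

Section Probability.
Variables (R : realType) (n : nat).
Hypotheses (n_even : ~~ odd n) (n_ge : (25 <= n)%N).
Local Notation N := (#|{: graph n}|%:R : R).

(** Chebyshev at level [n^(3/2)]: the second moment is [40 * 4^2 * n^2 = 640 n^2] per graph, against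
    a squared threshold [n^3]. *)
Lemma card_linstat_large f f' : taylor2 4 f f' -> (forall x, f (- x) = - f x) ->
  (forall x, `|f' x| <= 4 * `|x|) ->
  #|[set g : graph n | n%:R * Num.sqrt n%:R < `|linstat f g| :> R]|%:R <= 640 * N / n%:R.
Proof.
move=> ft fodd f'L.
have n0 : 0 < n%:R :> R by rewrite ltr0n; apply: leq_trans n_ge.
have t0 : 0 < n%:R * Num.sqrt n%:R :> R by rewrite mulr_gt0 ?sqrtr_gt0.
have := chebyshev_card t0 (linstat_second_moment n ft fodd f'L).
rewrite exprMn sqr_sqrtr ?(ltW n0) // ler_pdivlMr //.
have n2 : 0 < n%:R ^+ 2 :> R by rewrite exprn_gt0.
move: (#|_|%:R : R) => x h; rewrite -(ler_pM2l n2).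
by move: h; rewrite -[n%:R ^+ 2 * n%:R]mulrC; move: (n%:R : R) => m; lra.
Qed.

Lemma card_rowstat_large :
  #|[set g : graph n | n%:R ^+ 2 < `|rowstat R g|]|%:R <= 64 * N / n%:R.
Proof.
have n0 : 0 < n%:R :> R by rewrite ltr0n; apply: leq_trans n_ge.
have t0 : 0 < n%:R ^+ 2 :> R by rewrite exprn_gt0.
have := chebyshev_card t0 (rowstat_second_moment R n).
have n3 : 0 < n%:R ^+ 3 :> R by rewrite exprn_gt0.
move: (#|_|%:R : R) => x h; rewrite ler_pdivlMr // -(ler_pM2l n3).
by move: h; move: (n%:R : R) => m; lra.
Qed.

(** Union bound: [64 / n] for the row sums, [640 / n] for [sqrs] and [640 / n] for each dyadic
    scale; [704 = 64 + 640]. *)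
Lemma Pr_goodA7 (b : R) : 72 / Num.sqrt n%:R <= b ->
  1 - 704 * (1 + (trunc_log 2 n)%:R) / n%:R <= Pr R (@goodA7 R n b).
Proof.
move=> hb.
have n0 : 0 < n%:R :> R by rewrite ltr0n; apply: leq_trans n_ge.
have N0 : 0 < N.
  by rewrite ltr0n; apply/card_gt0P; exists [ffun=> true].
have s2 : Num.sqrt n%:R ^+ 2 = n%:R :> R by rewrite sqr_sqrtr ?(ltW n0).
have s5 : 5 <= Num.sqrt n%:R :> R.
  rewrite -(ler_pXn2r (n := 2)) ?nnegrE ?sqrtr_ge0 // s2.
  by rewrite -natrX ler_nat.
pose A := [set g : graph n | n%:R ^+ 2 < `|rowstat R g|].
pose B := [set g : graph n | n%:R * Num.sqrt n%:R < `|linstat (@sqrs R) g|].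
(* The indices [j < trunc_log 2 n] are those with [2^(j+1) <= n], the scales at which a median can
   lie. *)
pose D (j : 'I_(trunc_log 2 n)) :=
  [set g : graph n | n%:R * Num.sqrt n%:R < `|linstat (clip (2 ^+ j)) g| :> R].
have : (#|{: graph n}| <= #|[set g | `[< @goodA7 R n b g >]]| +
    (#|A| + #|B| + \sum_j #|D j|))%N.
  apply: card_cover => g; rewrite !inE -!leNgt => gA gB gD.
  have hrow : \sum_k rowsum R g k ^+ 2 <= 2 * n%:R ^+ 2.
    move: gA; rewrite ler_norml /rowstat => /andP[_].
    have : (n * n.-1)%:R <= n%:R ^+ 2 :> R by rewrite -natrX ler_nat leq_mul2l leq_pred orbT.
    lra.
  have hclip j : (2 ^ j.+1 <= n)%N ->
      `|linstat (clip (2 ^+ j)) g| <= n%:R * Num.sqrt n%:R :> R.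
    move=> jn; have jl : (j < trunc_log 2 n)%N by rewrite trunc_log_max.
    by have := gD (Ordinal jl); rewrite inE -leNgt.
  exact: (goodA7_of_statistics n_even s5 s2 hrow gB hclip hb).
rewrite -(ler_nat R) natrD natrD natrD natr_sum => h.
have h1 : #|A|%:R <= 64 * N / n%:R := card_rowstat_large.
have h2 : #|B|%:R <= 640 * N / n%:R.
  apply: card_linstat_large (@sqrsN R) _.
    by apply: taylor2W (@sqrs_taylor2 R); lra.
  by move=> x; rewrite normrM normr_id ger0_norm // ler_wpM2r //; lra.
have h3 : \sum_j #|D j|%:R <= (trunc_log 2 n)%:R * (640 * N / n%:R).
  rewrite mulr_natl -[X in _ *+ X](card_ord (trunc_log 2 n)) -sumr_const.
  apply: ler_sum => j _; apply: card_linstat_large (clip_taylor2 _) (clipN _) _ => x.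
  by apply: clip'_bound; rewrite exprn_ge0.
rewrite /Pr ler_pdivlMr //.
move: h h1 h2 h3; rewrite -!(mulrA _ N) -(mulrA _ _ n%:R^-1).
have i0 : 0 <= n%:R^-1 :> R by rewrite invr_ge0 ltW.
have l0 : 0 <= (trunc_log 2 n)%:R :> R by [].
have p0 : 0 <= N * n%:R^-1 by rewrite mulr_ge0 // ltW.
have q0 := mulr_ge0 l0 p0.
move: (#|_|%:R : R) (#|_|%:R : R) (#|_|%:R : R) (\sum_j _) q0 p0.
move: (n%:R^-1) (trunc_log 2 n)%:R => i l x y z w q0 p0 h h1 h2 h3.
nra.
Qed.

End Probability.

(** * Choice of the constants *)

Lemma trunc_log_le_ln (R : realType) n : (0 < n)%N ->
  (trunc_log 2 n)%:R * ln 2 <= ln n%:R :> R.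
Proof.
move=> n0; rewrite mulr_natl -lnXn // ler_ln ?posrE ?exprn_gt0 ?ltr0n //.
by rewrite -natrX ler_nat; have /andP[] := trunc_log_bounds (isT : (1 < 2)%N) n0.
Qed.

Theorem theoremA7 (R : realType) (eps : R) :
  0 < eps -> eps < 4^-1 ->
  exists (C : R) (K N : nat), 0 < C /\
    forall n : nat, (N <= n)%N -> ~~ odd n ->
      1 - C * (ln (n%:R : R)) ^+ K / n%:R
        <= Pr R (@goodA7 R n (C * (n%:R : R) `^ (2 * eps - 2^-1))).
Proof.
move=> eps0 _.
have ln2 : 0 < ln 2 :> R by rewrite ln_gt0 // ltr1n.
have il : 0 <= (ln 2)^-1 :> R by rewrite invr_ge0 ltW.
have c0 : 0 <= 1408 / ln 2 :> R by rewrite (mulr_ge0 (ler0n _ _) il).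
(* The first summand serves the probability, as [1 + trunc_log 2 n <= 2 ln n / ln 2]; the second
   serves the accuracy [72 / sqrt n]. From 25 on, [sqrt n] is at least 5. *)
exists (1408 / ln 2 + 72), 1%N, 25%N; split; first by lra.
move=> n n_ge n_even.
have n0 : (0 < n)%N by apply: leq_trans n_ge.
have nR : 0 < n%:R :> R by rewrite ltr0n.
(* Positivity of [eps] makes [n^(-1/2)] at most [n^(2 eps - 1/2)]. *)
have hb : 72 / Num.sqrt n%:R <= (1408 / ln 2 + 72) * n%:R `^ (2 * eps - 2^-1) :> R.
  apply: ler_pM; [by rewrite ler0n | by rewrite invr_ge0 sqrtr_ge0 | by rewrite lerDr |].
  rewrite -(powR12_sqrt (ltW nR)) -powRN ler_powR ?ler1n //; lra.
apply: le_trans (Pr_goodA7 n_even n_ge hb).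
rewrite expr1 lerD2l lerN2 ler_wpM2r ?invr_ge0 ?(ltW nR) //.
have h1 := trunc_log_le_ln R n0.
have h2 : 1 * ln 2 <= ln n%:R :> R.
  apply: le_trans h1; rewrite ler_wpM2r ?(ltW ln2) // ler1n trunc_log_gt0 /=.
  exact: leq_trans n_ge.
have h3 : 704 * (1 + (trunc_log 2 n)%:R) <= 1408 / ln 2 * ln n%:R :> R.
  rewrite -(ler_pM2r ln2) [leRHS]mulrAC divfK ?gt_eqF //.
  by lra.
apply: le_trans h3 _; rewrite ler_wpM2r ?lerDl ?ler0n //.
by apply: le_trans h2; rewrite mul1r ltW.
Qed.
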